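(* Let $n\ge 2$ and let $(g_2,\dots,g_n)$ be a tower, with $g_1=\mathbf 1$. Then $\mathrm{ev}(M_k)=g_k^{-1}$ for $1\le k\le n$. In particular $\mathrm{ev}(M_ng_n)=\mathbf 1$.
   Context: Permutations in $S_n$ are multiplied as functions: $(\pi g)(i)=\pi(g(i))$. For $1\le k\le n$, $G_k=\mathrm{Sym}\{1,\dots,k\}$ is the subgroup of $S_n$ of permutations fixing each of $k+1,\dots,n$. A $k$-cycle on $\{1,\dots,k\}$ is an element of $G_k$ that is a single cycle of length $k$. A tower is a sequence $(g_2,\dots,g_n)$ with $g_k\in G_k\setminus G_{k-1}$ such that, setting $g_1:=\mathbf 1$, each $u_k:=g_{k-1}^{-1}g_k$ is a $k$-cycle on $\{1,\dots,k\}$ $(2\le k\le n)$. Words over the alphabet $\{g_2,\dots,g_n\}$: $M_1=\varepsilon$ (empty word) and $M_k=(M_{k-1}\,g_k)^{k-1}M_{k-1}$ for $2\le k\le n$. For a word $w=w_1\cdots w_N$, $\mathrm{ev}(w)$ is the product $w_1w_2\cdots w_N$ in $S_n$ (with $\mathrm{ev}(\varepsilon)=\mathbf 1$). *)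

(* Defs.v *)
From mathcomp Require Import all_boot all_fingroup.

Set Implicit Arguments.
Unset Strict Implicit.
Unset Printing Implicit Defensive.

(* The points 1, ..., n are shifted to the elements 0, ..., n-1 of 'I_n. *)

(* In MathComp (s * t) i = t (s i); here the right factor acts first. *)
Definition fmul n (pi g : 'S_n) : 'S_n := (g * pi)%g.

Lemma fmulE n (pi g : 'S_n) (i : 'I_n) : fmul pi g i = pi (g i).
Proof. exact: permM. Qed.

Definition G n (k : nat) : {set 'S_n} := Sym [set i : 'I_n | i < k].

(* Some orbit has exactly k points and every point outside it is fixed. *)
Definition single_cycle n (k : nat) (u : 'S_n) : Prop :=
  exists2 x : 'I_n, #|porbit u x| = k & perm_on (porbit u x) u.

Definition k_cycle n (k : nat) (u : 'S_n) : Prop :=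
  u \in G n k /\ single_cycle k u.

(* Only the values g 1, ..., g n are constrained. *)
Definition tower n (g : nat -> 'S_n) : Prop :=
  g 1 = 1%g /\
  forall k, 2 <= k <= n ->
    g k \in G n k :\: G n k.-1 /\ k_cycle k (fmul (g k.-1)^-1%g (g k)).

(* M g 0 is a dummy value. *)
Fixpoint M n (g : nat -> 'S_n) (k : nat) : seq 'S_n :=
  match k with
  | (_.+1 as k1).+1 => flatten (nseq k1 (rcons (M g k1) (g k))) ++ M g k1
  | _ => [::]
  end.

Definition ev n (w : seq 'S_n) : 'S_n := foldr (@fmul n) 1%g w.

(* Main.v *)
Require Import Defs.
From mathcomp Require Import all_boot all_fingroup.

(** Evaluation turns concatenation of words into composition.  Suppose that
    [ev (M g k)] is the inverse of [g k].  Then the block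
    [rcons (M g k) (g k.+1)], which [M g k.+1] repeats [k] times, evaluates to
    the increment [u = fmul (g k)^-1 (g k.+1)] of the tower.  As [u] is a
    [k.+1]-cycle, [u ^+ k.+1 = 1] by [single_cycle_expg], so the [k] blocks
    together contribute [u^-1 = fmul (g k.+1)^-1 (g k)], and the final copy of
    [M g k] cancels the factor [g k].  What is left is the inverse of
    [g k.+1], and the result follows by induction on [k]. *)

Lemma ev_cat n (w1 w2 : seq 'S_n) : ev (w1 ++ w2) = fmul (ev w1) (ev w2).
Proof.
elim: w1 => [|x w1 IH] /=; first by rewrite /fmul mulg1.
by rewrite /ev /= -/(ev _) -/(ev w1) IH /fmul mulgA.
Qed.

Lemma ev_rcons n (w : seq 'S_n) x : ev (rcons w x) = fmul (ev w) x.
Proof. by rewrite -cats1 ev_cat /ev /= /fmul mul1g. Qed.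

Lemma ev_flatten_nseq n m (w : seq 'S_n) :
  ev (flatten (nseq m w)) = (ev w ^+ m)%g.
Proof.
by elim: m => [|m IH] //=; rewrite ev_cat IH /fmul expgSr.
Qed.

(** On the moved orbit every point is a power of [u] applied to the base
    point [x], and powers of [u] commute, so it suffices that going once round
    the orbit returns to [x]; the other points are fixed. *)
Lemma single_cycle_expg n k (u : 'S_n) : single_cycle k u -> (u ^+ k = 1)%g.
Proof.
case=> x <- u_on; apply/permP=> y; rewrite perm1.
have [/porbitP[i ->]|y_out] := boolP (y \in porbit u x).
  rewrite -permM -expgD addnC expgD permM; congr ((u ^+ i)%g _).
  by rewrite permX iter_porbit.
by rewrite permX iter_fix // (out_perm u_on y_out).
Qed.

Theorem lemma3p1 (n : nat) (hn : 2 <= n) (g : nat -> 'S_n) (hg : tower g) :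
  (forall k : nat, 1 <= k <= n -> ev (M g k) = (g k)^-1%g) /\
  ev (rcons (M g n) (g n)) = 1%g.
Proof.
case: hg => g1 g_step.
have ev_M k : 1 <= k <= n -> ev (M g k) = (g k)^-1%g.
  case: k => // k; elim: k => [|k IH] le_kn; first by rewrite g1 invg1.
  have [_ [_ /single_cycle_expg uk1]] := g_step k.+2 le_kn.
  have {}IH := IH (ltnW le_kn).
  have -> : M g k.+2 =
      flatten (nseq k.+1 (rcons (M g k.+1) (g k.+2))) ++ M g k.+1 by [].
  rewrite ev_cat ev_flatten_nseq ev_rcons IH.
  set u := fmul _ _ in uk1 *.
  have -> : (u ^+ k.+1 = u^-1)%g.
    by apply/eqP; rewrite eq_sym eq_invg_mul -expgS uk1.
  by rewrite /u /fmul invMg invgK mulKg.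
by split=> //; rewrite ev_rcons ev_M ?leqnn ?(ltnW hn) // /fmul mulgV.
Qed.
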